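(* Let $A\in\mathbb{R}^{l\times m}$, $B\in\mathbb{R}^{n\times m}$ with $C=\ker A\cap\mathbb{R}^m_>\neq\emptyset$ and $d_P=d$, and let $P$, $T$, $D$ and $F\colon\mathbb{R}^{d_P}\to\mathbb{R}^d_>$ be as defined in the context. The following statements are equivalent: (i) The map $F$ is not locally invertible. (ii) There exist $y\in P$ and nonzero $t\in T$ and $\bar d\in D^\perp$ such that $t=y\circ\bar d$.
   Context: Notation: $\mathbb{R}_>$ are the positive reals, $\mathbb{R}_\ge$ the nonnegative reals, $\circ$ is the componentwise product, $1_m\in\mathbb{R}^m$ is the all-ones vector. For $x\in\mathbb{R}^m_>$ and $y\in\mathbb{R}^m$, $x^y=\prod_i x_i^{y_i}$; for a matrix $Y=(y^1,\ldots,y^r)\in\mathbb{R}^{m\times r}$ with columns $y^j$, $x^Y\in\mathbb{R}^r_>$ has components $(x^Y)_j=x^{y^j}$. Coefficient polytope: $P=C\cap\Delta$ with $C=\ker A\cap\mathbb{R}^m_>$ (assumed nonempty) and $\Delta=\{y\in\mathbb{R}^m_\ge\mid 1_m\cdot y=1\}$; $d_P=\dim P$. $P$ is relatively open; its closure $\overline P$ is a polytope with vertices $v^1,\ldots,v^{n_P}\in\mathbb{R}^m$. Subspaces: $\mathcal{A}=\begin{pmatrix}A\\1_m^{\mathsf T}\end{pmatrix}$, $T=\ker\mathcal{A}$ (of dimension $d_P$), $T=\operatorname{im}G$ with $G\in\mathbb{R}^{m\times d_P}$ having orthonormal columns. $\mathcal{B}=\begin{pmatrix}B\\1_m^{\mathsf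 T}\end{pmatrix}$, $D=\ker\mathcal{B}$, $d=\dim D$, $D=\operatorname{im}H$ with basis matrix $H\in\mathbb{R}^{m\times d}$. Standing assumption: $d_P=d$. Parametrization $p\colon\mathbb{R}^{d_P}\to P$ (a real analytic isomorphism) and map $F$: \[ p(\xi)=\frac{\sum_{k=1}^{n_P}\mathrm{e}^{v^k\cdot G\xi}\,v^k}{\sum_{k=1}^{n_P}\mathrm{e}^{v^k\cdot G\xi}},\qquad F\colon\mathbb{R}^{d_P}\to\mathbb{R}^d_>,\quad F(\xi)=p(\xi)^H . \] $F$ is locally invertible if its Jacobian matrix $J_F(\xi)$ is injective for all $\xi\in\mathbb{R}^{d_P}$. *)

(* Defs.v *)
From HB Require Import structures.
From mathcomp Require Export all_boot all_order all_algebra.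
From mathcomp Require Export all_classical all_reals all_analysis.
Export numFieldNormedType.Exports.

Set Implicit Arguments.
Unset Strict Implicit.
Unset Printing Implicit Defensive.

Import Order.TTheory GRing.Theory Num.Theory.

Local Open Scope classical_set_scope.
Local Open Scope ring_scope.

(* Vectors of R^m are column vectors; matrices act on them from the left. *)

Definition dot (R : realType) (m : nat) (x y : 'cV[R]_m) : R :=
  \sum_i x i 0 * y i 0.

Definition mx_kernel (R : realType) (l m : nat) (A : 'M[R]_(l, m)) :
    set 'cV[R]_m :=
  [set x | A *m x = 0].

Definition mx_image (R : realType) (m k : nat) (M : 'M[R]_(m, k)) :
    set 'cV[R]_m :=
  range (fun c : 'cV[R]_k => M *m c).

Definition mx_injective (R : realType) (m k : nat) (M : 'M[R]_(m, k)) : Prop :=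
  injective (fun c : 'cV[R]_k => M *m c).

Definition orth (R : realType) (m : nat) (S : set 'cV[R]_m) : set 'cV[R]_m :=
  [set x | forall s, S s -> dot x s = 0].

Definition orthonormal_cols (R : realType) (m k : nat) (M : 'M[R]_(m, k)) :
    Prop :=
  forall i j, dot (col i M) (col j M) = (i == j)%:R.

Definition basis_mx (R : realType) (m k : nat) (M : 'M[R]_(m, k))
    (S : set 'cV[R]_m) : Prop :=
  mx_injective M /\ mx_image M = S.

(* The affine hull of S is z + im M, where the k columns of M are linearly
   independent and z and all z + M_j belong to S.  The empty set has no
   dimension in this sense. *)
Definition affine_dim (R : realType) (m : nat) (S : set 'cV[R]_m) (k : nat) :
    Prop :=
  exists (z : 'cV[R]_m) (M : 'M[R]_(m, k)),
    [/\ S z, forall j, S (z + col j M), mx_injective M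
      & forall x, S x -> mx_image M (x - z)].

(* The vertices of a polytope are its extreme points. *)
Definition vertices (R : realType) (m : nat) (K : set 'cV[R]_m) :
    set 'cV[R]_m :=
  [set z | K z /\
    forall (x y : 'cV[R]_m) (s : R), K x -> K y -> 0 < s < 1 ->
      z = s *: x + (1 - s) *: y -> x = z /\ y = z].

Definition coef_cone (R : realType) (l m : nat) (A : 'M[R]_(l, m)) :
    set 'cV[R]_m :=
  mx_kernel A `&` [set x | forall i, 0 < x i 0].

Definition simplex (R : realType) (m : nat) : set 'cV[R]_m :=
  [set y : 'cV[R]_m | (forall i, 0 <= y i 0) /\ dot (const_mx 1) y = 1].

Definition coef_polytope (R : realType) (l m : nat) (A : 'M[R]_(l, m)) :
    set 'cV[R]_m :=
  coef_cone A `&` @simplex R m.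

(* The kernel of A with the row 1_m^T appended: T for the coefficient matrix,
   D for the exponent matrix. *)
Definition aug_kernel (R : realType) (l m : nat) (A : 'M[R]_(l, m)) :
    set 'cV[R]_m :=
  mx_kernel (col_mx A (const_mx 1 : 'rV[R]_m)).

Definition hadamard (R : realType) (m : nat) (x y : 'cV[R]_m) : 'cV[R]_m :=
  \col_i (x i 0 * y i 0).

(* Only meaningful for positive x. *)
Definition mx_power (R : realType) (m r : nat) (x : 'cV[R]_m)
    (Y : 'M[R]_(m, r)) : 'cV[R]_r :=
  \col_j \prod_i (x i 0) `^ (Y i j).

Definition param (R : realType) (m k N : nat) (v : 'I_N -> 'cV[R]_m)
    (G : 'M[R]_(m, k)) (xi : 'cV[R]_k) : 'cV[R]_m :=
  (\sum_i expR (dot (v i) (G *m xi)))^-1 *: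
    \sum_i expR (dot (v i) (G *m xi)) *: v i.

Definition param_power (R : realType) (m k d N : nat) (v : 'I_N -> 'cV[R]_m)
    (G : 'M[R]_(m, k)) (H : 'M[R]_(m, d)) (xi : 'cV[R]_k) : 'cV[R]_d :=
  mx_power (param v G xi) H.

(* The matrix of partial derivatives; the library's 'J f p is its transpose,
   for functions between spaces of row vectors. *)
Definition jacobian_mx (R : realType) (k d : nat) (f : 'cV[R]_k -> 'cV[R]_d)
    (xi : 'cV[R]_k) : 'M[R]_(d, k) :=
  \matrix_(i < d, j < k)
    ('D_(delta_mx j 0) (fun x => f x i 0) xi : R).

Definition locally_invertible (R : realType) (k d : nat)
    (f : 'cV[R]_k -> 'cV[R]_d) : Prop :=
  forall xi, mx_injective (jacobian_mx f xi).

(* Main.v *)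
Require Import Defs.
From mathcomp Require Import ring lra.

Set Implicit Arguments.
Unset Strict Implicit.
Unset Printing Implicit Defensive.

Import Order.TTheory GRing.Theory Num.Theory.
Local Open Scope classical_set_scope.
Local Open Scope ring_scope.

(** The point p(xi) is the mean of the vertices under the probability weights
    proportional to exp (v_i . G xi).  As for every exponential family, the
    derivative of this mean is a covariance: J_p = V G, where V is the
    covariance matrix of the vertices under these weights ([is_derive_param]).
    Taking logarithms of the monomials gives
    J_F = diag(F) H^T diag(1/p) V G ([jacobian_param_power]).  Since F > 0 and
    im H = D, a vector u lies in the kernel of J_F(xi) iff
    dbar = t / p(xi), with t = V G u, is orthogonal to D, that is, iff
    t = y o dbar with y = p(xi) and dbar orthogonal to D.

    So the theorem reduces to two facts about P.  First, V maps T = im G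
    bijectively onto T ([tilt_cov_inj], [tilt_cov_surj]), so that u and t
    determine each other and vanish together.  Second, p takes its values in P
    ([param_in_polytope]) and reaches every point of P ([param_surj]): the
    parameter of y is a minimizer of the convex function
    sum_i exp ((v_i - y) . G xi), whose gradient is a positive multiple of
    G^T (p(xi) - y).

    The injectivity of V and the existence of the minimizer both follow from
    [coef_polytope_width]: seen from a point y of P, in every nonzero direction
    of T some vertex lies at least a fixed distance delta > 0 ahead of y.  This
    uses that a linear form on a compact set is maximal at some extreme point
    ([compact_vertex_ge]). *)

(** * The dot product *)

Lemma dotE (R : realType) m (x y : 'cV[R]_m) : dot x y = (x^T *m y) 0 0.
Proof. by rewrite mxE; apply: eq_bigr => i _; rewrite mxE. Qed.

Lemma dotC (R : realType) m (x y : 'cV[R]_m) : dot x y = dot y x.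
Proof. by apply: eq_bigr => i _; rewrite mulrC. Qed.

Lemma dotDr (R : realType) m (x y z : 'cV[R]_m) :
  dot x (y + z) = dot x y + dot x z.
Proof. by rewrite !dotE mulmxDr mxE. Qed.

Lemma dotZr (R : realType) m a (x y : 'cV[R]_m) : dot x (a *: y) = a * dot x y.
Proof. by rewrite !dotE -scalemxAr mxE. Qed.

Lemma dotZl (R : realType) m a (x y : 'cV[R]_m) : dot (a *: x) y = a * dot x y.
Proof. by rewrite dotC dotZr dotC. Qed.

Lemma dot_comb2 (R : realType) m a b (x y : 'cV[R]_m) :
  dot (a *: x + b *: y) (a *: x + b *: y) =
  a ^+ 2 * dot x x + 2 * a * b * dot x y + b ^+ 2 * dot y y.
Proof.
by rewrite dotDr !dotZr !(dotC (_ + _)) !dotDr !dotZr (dotC y x); ring.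
Qed.

Lemma dotBl (R : realType) m (x y z : 'cV[R]_m) :
  dot (x - y) z = dot x z - dot y z.
Proof. by rewrite !dotE linearB mulmxBl !mxE. Qed.

Lemma dot0r (R : realType) m (x : 'cV[R]_m) : dot x 0 = 0.
Proof. by rewrite dotE mulmx0 mxE. Qed.

Lemma dot_mulmxr (R : realType) m k (M : 'M[R]_(m, k)) x y :
  dot x (M *m y) = dot (M^T *m x) y.
Proof. by rewrite !dotE trmx_mul trmxK mulmxA. Qed.

Lemma dotxx_ge0 (R : realType) m (x : 'cV[R]_m) : 0 <= dot x x.
Proof. by apply: sumr_ge0 => i _; rewrite -expr2 sqr_ge0. Qed.

Lemma sqr_coord_le_dotxx (R : realType) m (x : 'cV[R]_m) i :
  x i 0 ^+ 2 <= dot x x.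
Proof.
rewrite /dot (bigD1 i)//= -expr2 lerDl.
by apply: sumr_ge0 => j _; rewrite -expr2 sqr_ge0.
Qed.

Lemma dotxx_eq0 (R : realType) m (x : 'cV[R]_m) : dot x x = 0 -> x = 0.
Proof.
move=> x0; apply/colP => i; rewrite mxE; apply/eqP; rewrite -sqrf_eq0.
by rewrite eq_le sqr_ge0 andbT -x0 sqr_coord_le_dotxx.
Qed.

Lemma orthonormal_colsP (R : realType) m k (G : 'M[R]_(m, k)) :
  orthonormal_cols G -> G^T *m G = 1%:M.
Proof.
move=> Go; apply/matrixP => i j; rewrite !mxE -Go.
by apply: eq_bigr => a _; rewrite !mxE.
Qed.

(** * Compact sets of column vectors *)

Lemma trmx_continuous (R : realType) m n :
  continuous (@trmx R m n).
Proof.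
move=> x s /nbhs_ballP [e e0 es].
apply/nbhs_ballP; exists e => // y [_ xy]; apply: es.
by split=> // i j; rewrite !mxE; exact: xy.
Qed.

Lemma cV_cube_compact (R : realType) m (M : R) :
  compact [set x : 'cV[R]_m | forall i, `|x i 0| <= M].
Proof.
have cube : compact [set x : 'rV[R]_m | forall i, `[- M, M]%classic (x 0 i)].
  apply: (@rV_compact R m (fun=> `[- M, M]%classic)) => _.
  exact: segment_compact.
have := continuous_compact (continuous_subspaceT (@trmx_continuous R 1 m)) cube.
congr compact; apply/seteqP; split=> x /=.
  by move=> [y yM <-] i; move: (yM i); rewrite mxE /= in_itv /= -ler_norml.
move=> xM; exists x^T; last exact: trmxK.
by move=> i; rewrite mxE /= in_itv /= -ler_norml.
Qed.

Lemma continuous_sumr (R : realType) (T : topologicalType) (I : finType)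
    (f : I -> T -> R) :
  (forall i, continuous (f i)) -> continuous (fun x => \sum_i f i x).
Proof.
move=> fc; apply: (@continuous_big R I +%R 0 xpredT _ T) => [|i _].
  exact: add_continuous.
exact: fc.
Qed.

Lemma dot_continuous (R : realType) m (x : 'cV[R]_m) : continuous (dot x).
Proof.
apply: (@continuous_sumr _ _ _ (fun i (y : 'cV[R]_m) => x i 0 * y i 0)) => i y.
apply: (@continuousM _ _ (fun=> x i 0) (fun y : 'cV[R]_m => y i 0)).
  exact: cst_continuous.
exact: coord_continuous.
Qed.

Lemma dotxx_continuous (R : realType) m :
  continuous (fun x : 'cV[R]_m => dot x x).
Proof.
apply: (@continuous_sumr _ _ _ (fun i (y : 'cV[R]_m) => y i 0 * y i 0)) => i y.
by apply: (@continuousM _ _ (fun y : 'cV[R]_m => y i 0) (fun y => y i 0));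
  exact: coord_continuous.
Qed.

(** * Vertices *)

(** On the face where the linear form is maximal, a point of maximal Euclidean
    norm is extreme, because the squared norm is strictly convex. *)
Lemma compact_vertex_ge (R : realType) m (K : set 'cV[R]_m) (g y : 'cV[R]_m) :
  compact K -> K y -> exists2 z, vertices K z & dot g y <= dot g z.
Proof.
move=> Kc Ky.
have [] := compact_EVT_max (ex_intro _ y Ky) Kc
  (continuous_subspaceT (@dot_continuous _ _ g)).
move=> z0; rewrite inE => Kz0 z0_max.
pose K0 := K `&` dot g @^-1` [set dot g z0].
have K0c : compact K0.
  apply: compact_closedI => //; apply: preimage_closed; last exact: closed_eq.
  by move=> ? _; exact: dot_continuous.
have [] := compact_EVT_max (ex_intro _ z0 (conj Kz0 erefl) : K0 !=set0) K0c
  (continuous_subspaceT (@dotxx_continuous _ _)).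
move=> z; rewrite inE => -[Kz gz] z_max; exists z; last first.
  by rewrite gz; apply: z0_max; rewrite inE.
split=> // x1 x2 s Kx1 Kx2 /andP[s0 s1] zE.
have s1' : 0 < 1 - s by rewrite subr_gt0.
have g1 : dot g x1 <= dot g z by rewrite gz; apply: z0_max; rewrite inE.
have g2 : dot g x2 <= dot g z by rewrite gz; apply: z0_max; rewrite inE.
have gE : dot g z = s * dot g x1 + (1 - s) * dot g x2.
  by rewrite {1}zE dotDr !dotZr.
have g1E : dot g x1 = dot g z by nra.
have g2E : dot g x2 = dot g z by nra.
have n1 : dot x1 x1 <= dot z z.
  by apply: z_max; rewrite inE; split => //=; rewrite g1E.
have n2 : dot x2 x2 <= dot z z.
  by apply: z_max; rewrite inE; split => //=; rewrite g2E.
have nE : dot z z = s * dot x1 x1 + (1 - s) * dot x2 x2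
    - s * (1 - s) * dot (x1 - x2) (x1 - x2).
  have -> : x1 - x2 = 1 *: x1 + (-1) *: x2 by rewrite scale1r scaleN1r.
  by rewrite {1 2}zE !dot_comb2; ring.
have n12 : dot (x1 - x2) (x1 - x2) = 0.
  apply/eqP; rewrite eq_le dotxx_ge0 andbT.
  by rewrite -(pmulr_rle0 _ (mulr_gt0 s0 s1')); nra.
have x12 : x1 = x2 by apply/eqP; rewrite -subr_eq0 (dotxx_eq0 n12).
by rewrite zE -x12 -scalerDl addrC subrK scale1r.
Qed.

(** * The coefficient polytope *)

Lemma dot_delta (R : realType) m i (x : 'cV[R]_m) :
  dot (delta_mx i 0) x = x i 0.
Proof.
rewrite /dot (bigD1 i)//= mxE !eqxx mul1r big1 ?addr0// => j /negbTE ji.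
by rewrite mxE ji mul0r.
Qed.

Lemma closure_dot_ge (R : realType) m (S : set 'cV[R]_m) g a :
  (forall x, S x -> a <= dot g x) -> forall x, closure S x -> a <= dot g x.
Proof.
move=> Sa; rewrite closureE; apply: smallest_sub => //.
apply: (@preimage_closed _ _ (dot g) [set r | a <= r]); last exact: closed_ge.
by move=> x _; exact: dot_continuous.
Qed.

Lemma closure_dot_eq (R : realType) m (S : set 'cV[R]_m) g a :
  (forall x, S x -> dot g x = a) -> forall x, closure S x -> dot g x = a.
Proof.
move=> Sa x Sx; apply/eqP; rewrite eq_le; apply/andP; split; last first.
  by apply: (closure_dot_ge _ Sx) => z /Sa ->.
rewrite -lerN2 -mulN1r -(mulN1r (dot g x)) -dotZl.
apply: (closure_dot_ge _ Sx) => z /Sa <-.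
by rewrite dotZl.
Qed.

Lemma mulmx_dot (R : realType) l m (A : 'M[R]_(l, m)) (x : 'cV[R]_m) i :
  (A *m x) i 0 = dot (row i A)^T x.
Proof. by rewrite mxE; apply: eq_bigr => j _; rewrite !mxE. Qed.

Lemma aug_kernelP (R : realType) l m (A : 'M[R]_(l, m)) (t : 'cV[R]_m) :
  aug_kernel A t <-> A *m t = 0 /\ dot (const_mx 1) t = 0.
Proof.
rewrite /aug_kernel /mx_kernel /= mul_col_mx.
have -> : (const_mx 1 : 'rV[R]_m) *m t = (dot (const_mx 1) t)%:M.
  by apply/matrixP => i j; rewrite !ord1 dotE trmx_const [RHS]mxE.
split=> [/eqP|[-> ->]].
  rewrite col_mx_eq0 => /andP[/eqP -> /eqP /matrixP /(_ 0 0)].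
  by rewrite !mxE eqxx mulr1n.
by apply/eqP; rewrite col_mx_eq0 eqxx raddf0 eqxx.
Qed.

Section polytope.
Variables (R : realType) (l m : nat) (A : 'M[R]_(l, m)).
Let P := coef_polytope A.

Lemma closure_coef_polytope x : closure P x -> A *m x = 0 /\ simplex x.
Proof.
move=> Px; split; first apply/colP => i.
  rewrite mulmx_dot [RHS]mxE; apply: (closure_dot_eq _ Px) => z [[Az _] _].
  by rewrite -mulmx_dot Az mxE.
split=> [i|].
  rewrite -dot_delta; apply: (closure_dot_ge _ Px) => z [_ [z_ge0 _]].
  by rewrite dot_delta.
by apply: (closure_dot_eq _ Px) => z [_ []].
Qed.

Lemma closure_coef_polytope_compact : compact (closure P).
Proof.
apply: subclosed_compact (@closed_closure _ _) (@cV_cube_compact R m 1) _.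
move=> x /closure_coef_polytope[_ [x_ge0 x1]] i /=.
rewrite ger0_norm// -x1 /dot (bigD1 i)//= mxE mul1r lerDl.
by apply: sumr_ge0 => j _; rewrite mxE mul1r.
Qed.

Lemma coef_polytope_vertex_ge g y : P y ->
  exists2 z, vertices (closure P) z & dot g y <= dot g z.
Proof.
move=> Py; apply: compact_vertex_ge; first exact: closure_coef_polytope_compact.
exact: subset_closure.
Qed.

(** Since y has positive coordinates, it can be moved by a fixed distance in
    any direction t of T without leaving P; the new point is ahead of y in that
    direction, and some vertex is at least as far ahead. *)
Lemma coef_polytope_width y : P y ->
  exists2 delta, 0 < delta & forall t, aug_kernel A t ->
    exists2 z, vertices (closure P) z &
      delta * Num.sqrt (dot t t) <= dot (z - y) t.
Proof.
move=> Py; have [[Ay y_gt0] [_ y1]] := Py.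
have [e e_gt0 ey] : exists2 e, 0 < e & forall i, e <= y i 0.
  exists (\big[Order.min/1]_i y i 0); last by move=> i; exact: bigmin_le.
  by apply: lt_bigmin => // i _; exact: y_gt0.
exists (e / 2); first by rewrite divr_gt0.
move=> t /aug_kernelP[At t1]; set r := Num.sqrt _.
have r_ge0 : 0 <= r by exact: sqrtr_ge0.
have r2 : r ^+ 2 = dot t t by rewrite sqr_sqrtr// dotxx_ge0.
(* if t = 0, then r^-1 = 0 and y' = y *)
pose y' := y + (e / 2 / r) *: t.
have Py' : P y'.
  have y'_gt0 i : 0 < y' i 0.
    rewrite !mxE; have : `|e / 2 / r * t i 0| <= e / 2.
      rewrite normrM ger0_norm; last by rewrite divr_ge0// divr_ge0// ltW.
      have [r0|r_neq0] := eqVneq r 0.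
        by rewrite r0 invr0 mulr0 mul0r divr_ge0// ltW.
      rewrite -(mulrA (e / 2)) ler_piMr//; first by rewrite divr_ge0// ltW.
      rewrite mulrC ler_pdivrMr ?lt_def ?r_neq0// mul1r.
      by rewrite -sqrtr_sqr ler_wsqrtr// sqr_coord_le_dotxx.
    by rewrite ler_norml => /andP[+ _]; have := ey i; lra.
  split; [split|split] => //.
  - by rewrite /mx_kernel /= mulmxDr -scalemxAr At Ay scaler0 addr0.
  - by move=> i; exact: ltW.
  - by rewrite dotDr dotZr t1 y1 mulr0 addr0.
have [z Vz yz] := coef_polytope_vertex_ge t Py'.
exists z => //; rewrite dotBl lerBrDl ![dot _ t]dotC; apply: le_trans yz.
rewrite dotDr dotZr -r2 lerD2l expr2 mulrA.
by have [->|r_neq0] := eqVneq r 0; rewrite ?mulr0// divfK.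
Qed.

End polytope.

(** * Derivatives of exponential sums *)

Lemma is_derive_sumr (R : realType) N (f : 'I_N -> R -> R) (df : 'I_N -> R)
    (x : R) :
  (forall k, is_derive x 1 (f k) (df k)) ->
  is_derive x 1 (fun y => \sum_k f k y) (\sum_k df k).
Proof.
move=> fdf; have -> : (fun y => \sum_k f k y) = \sum_k f k.
  by apply/funext => y; rewrite fct_sumE.
exact: is_derive_sum.
Qed.

Lemma is_derive_exp_sum (R : realType) N (a b c : 'I_N -> R) (h : R) :
  is_derive h 1 (fun h => \sum_k expR (h * b k + a k) * c k)
    (\sum_k expR (h * b k + a k) * b k * c k).
Proof.
apply: is_derive_sumr => k.
have lin : is_derive h 1 (fun h => h * b k + a k) (b k).
  have -> : (fun h => h * b k + a k) = b k \*: id + cst (a k).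
    by apply/funext => x; rewrite mulrC.
  by apply: is_derive_eq; rewrite addr0 [LHS]mulr1.
have ex := @is_derive1_comp R expR (fun h => h * b k + a k) h _ _
  (is_derive_expR _) lin.
have -> : (fun h => expR (h * b k + a k) * c k) =
    c k \*: (expR \o fun h => h * b k + a k).
  by apply/funext => x; rewrite /= mulrC.
apply: is_derive_eq (is_deriveZ _ ex) _.
by rewrite [_ *: _]mulrC.
Qed.

(** * Critical points of exponential sums *)

Lemma dot_line (R : realType) k (c u x : 'cV[R]_k) h :
  dot c (h *: u + x) = h * dot c u + dot c x.
Proof. by rewrite dotDr dotZr. Qed.

Lemma dot_suml (R : realType) m N (w : 'I_N -> R) (c : 'I_N -> 'cV[R]_m) x :
  dot (\sum_k w k *: c k) x = \sum_k w k * dot (c k) x.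
Proof.
rewrite dotC dotE mulmx_sumr summxE; apply: eq_bigr => k _.
by rewrite -scalemxAr mxE -dotE dotC.
Qed.

(** The hypothesis makes the sum of exponentials coercive, so it has a
    minimizer, and there its gradient vanishes. *)
Lemma exp_sum_critical_point (R : realType) N k (c : 'I_N -> 'cV[R]_k)
    (delta : R) :
  0 < delta ->
  (forall (x : 'cV[R]_k) j, exists i, delta * `|x j 0| <= dot (c i) x) ->
  exists x, \sum_i expR (dot (c i) x) *: c i = 0.
Proof.
move=> delta_gt0 coercive.
pose phi x := \sum_i expR (dot (c i) x).
have phi_cont : continuous phi.
  apply: (@continuous_sumr _ _ _ (fun i x => expR (dot (c i) x))) => i x.
  apply: continuous_comp; first exact: dot_continuous.
  exact: continuous_expR.
pose M := N%:R / delta.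
have M_ge0 : 0 <= M by rewrite divr_ge0// ltW.
pose Q := [set x : 'cV[R]_k | forall i, `|x i 0| <= M].
have Q0 : Q 0 by move=> i; rewrite mxE normr0.
have [x0 _ x0_min] := compact_EVT_min (ex_intro _ 0 Q0) (@cV_cube_compact R k M)
  (continuous_subspaceT phi_cont).
(* outside the cube, phi exceeds N, its value at the origin *)
have {}x0_min x : phi x0 <= phi x.
  have [Qx|Qx] := pselect (Q x); first by apply: x0_min; rewrite inE.
  apply: (@le_trans _ _ (phi 0)); first by apply: x0_min; rewrite inE.
  have -> : phi 0 = N%:R.
    rewrite /phi (eq_bigr (fun=> 1)) => [|i _]; last by rewrite dot0r expR0.
    by rewrite sumr_const card_ord.
  have [j xj] : exists j, M < `|x j 0|.
    by apply/not_existsP => xM; apply: Qx => j; rewrite leNgt; apply/negP/xM.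
  have [i xi] := coercive x j.
  apply: (@le_trans _ _ (expR (dot (c i) x))); last first.
    by rewrite /phi (bigD1 i)//= lerDl sumr_ge0// => *; exact: expR_ge0.
  have NM : N%:R = delta * M by rewrite mulrC divfK// gt_eqF.
  apply: le_trans (expR_ge1Dx _); rewrite NM.
  have : delta * M <= delta * `|x j 0| by rewrite ler_pM2l// ltW.
  lra.
exists x0; set g := LHS; apply: dotxx_eq0; rewrite {1}/g dot_suml.
pose f h := \sum_i expR (h * dot (c i) g + dot (c i) x0) * 1.
have fE h : f h = phi (h *: g + x0).
  by apply: eq_bigr => i _; rewrite dot_line mulr1.
have df h := is_derive_exp_sum (fun i => dot (c i) x0) (fun i => dot (c i) g)
  (fun=> 1) h.
have f0 : is_derive (0 : R) (1 : R) f 0.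
  apply: (@derive1_at_min R f (-1) 1) => [|t _||].
  - lra.
  - by case: (df t).
  - by rewrite in_itv /=; apply/andP; split; lra.
  - by move=> t _; rewrite !fE scale0r add0r.
transitivity ('D_1 f (0 : R)); last by case: f0.
have [_ ->] := df 0.
by apply: eq_bigr => i _; rewrite mul0r add0r mulr1.
Qed.

(** * The Jacobian matrix of the monomial map *)

Lemma derive_line (R : realType) k (f : 'cV[R]_k -> R) x u :
  'D_u f x = 'D_1 (fun h : R => f (h *: u + x)) 0.
Proof.
rewrite /derive.
suff -> : (fun h : R => h^-1 *: ((f \o shift x) (h *: u) - f x)) =
    (fun h : R => h^-1 *: (((fun h => f (h *: u + x)) \o shift 0) (h *: 1)
                           - f (0 *: u + x))) by [].
by apply/funext => h /=; rewrite scale0r add0r addr0 [h *: 1]mulr1.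
Qed.

Section param.
Variables (R : realType) (m k N : nat).
Variables (v : 'I_N -> 'cV[R]_m) (G : 'M[R]_(m, k)).
Implicit Types xi u : 'cV[R]_k.

Definition tilt_weight xi i := expR (dot (v i) (G *m xi)).

Definition tilt_mass xi := \sum_i tilt_weight xi i.

(** The covariance matrix of the vertices under the probability weights that
    define the point of P with parameter xi. *)
Definition tilt_cov xi : 'M[R]_m :=
  (tilt_mass xi)^-1 *: \sum_i tilt_weight xi i *:
    ((v i - param v G xi) *m (v i - param v G xi)^T).

Hypothesis N_gt0 : (0 < N)%N.

Lemma tilt_mass_gt0 xi : 0 < tilt_mass xi.
Proof.
rewrite /tilt_mass (bigD1 (Ordinal N_gt0))//= ltr_pwDl ?expR_gt0//.
by apply: sumr_ge0 => i _; exact: expR_ge0.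
Qed.

Lemma paramE xi : param v G xi =
  (tilt_mass xi)^-1 *: \sum_i tilt_weight xi i *: v i.
Proof. by []. Qed.

Lemma tilt_centered xi : \sum_i tilt_weight xi i *: (v i - param v G xi) = 0.
Proof.
under eq_bigr do rewrite scalerBr.
rewrite sumrB -scaler_suml paramE scalerA mulfV ?scale1r ?subrr//.
by rewrite gt_eqF// tilt_mass_gt0.
Qed.

Lemma tilt_cov_mul xi t : tilt_cov xi *m t = (tilt_mass xi)^-1 *:
  \sum_i (tilt_weight xi i * dot (v i - param v G xi) t) *:
    (v i - param v G xi).
Proof.
rewrite -scalemxAl mulmx_suml; congr (_ *: _); apply: eq_bigr => i _.
rewrite -scalemxAl -mulmxA [_^T *m t]mx11_scalar -dotE mul_mx_scalar.
by rewrite scalerA.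
Qed.

(** The quadratic form of the covariance is a sum of squares with positive
    weights. *)
Lemma tilt_cov_eq0 xi t : tilt_cov xi *m t = 0 ->
  forall i, dot (v i - param v G xi) t = 0.
Proof.
rewrite tilt_cov_mul => /(congr1 (fun x => dot x t)).
rewrite dotZl dot_suml [dot 0 _]dotC dot0r => /eqP.
rewrite mulf_eq0 invr_eq0 gt_eqF ?tilt_mass_gt0//= => /eqP sum0 i.
have /eqP := sum0; rewrite psumr_eq0 => [/allP|j _]; last first.
  by rewrite -mulrA mulr_ge0 ?expR_ge0// -expr2 sqr_ge0.
move=> /(_ i (mem_index_enum _)); rewrite /= -mulrA mulf_eq0.
by rewrite gt_eqF ?expR_gt0//= mulf_eq0 orbb => /eqP.
Qed.

(** The derivative of the mean of an exponential family is its covariance. *)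
Lemma is_derive_param xi u i :
  is_derive (0 : R) (1 : R) (fun h : R => param v G (h *: u + xi) i 0)
    ((tilt_cov xi *m (G *m u)) i 0).
Proof.
pose a j := dot (v j) (G *m xi); pose b j := dot (v j) (G *m u).
have weightE h j : tilt_weight (h *: u + xi) j = expR (h * b j + a j).
  by rewrite /tilt_weight mulmxDr -scalemxAr dot_line.
have weight0 j : tilt_weight xi j = expR (0 * b j + a j).
  by rewrite mul0r add0r.
pose num h := \sum_j expR (h * b j + a j) * v j i 0.
pose den h := \sum_j expR (h * b j + a j) * 1.
have den0 : den 0 = tilt_mass xi.
  by apply: eq_bigr => j _; rewrite weight0 mulr1.
have den0_neq0 : den 0 != 0 by rewrite den0 gt_eqF// tilt_mass_gt0.
have pE : (fun h : R => param v G (h *: u + xi) i 0) =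
    num * (fun h => (den h)^-1).
  apply/funext => h; rewrite paramE !mxE summxE [RHS]mulrC; congr (_^-1 * _).
    by apply: eq_bigr => j _; rewrite weightE mulr1.
  by apply: eq_bigr => j _; rewrite mxE weightE.
have dnum := is_derive_exp_sum a b (fun j => v j i 0) 0.
have dden := is_derive_exp_sum a b (fun=> 1) 0.
have dinv := @is_deriveV R den 0 _ 1 den0_neq0 dden.
rewrite pE; apply: is_derive_eq (is_deriveM dnum dinv) _.
(* the quotient rule, with the centring term of the covariance vanishing *)
have covE : (tilt_cov xi *m (G *m u)) i 0 = (tilt_mass xi)^-1 *
    \sum_j tilt_weight xi j * b j * (v j i 0 - param v G xi i 0).
  have /matrixP/(_ i 0) := tilt_centered xi.
  rewrite summxE [RHS]mxE => centered.
  rewrite tilt_cov_mul mxE summxE; congr (_ * _).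
  have := congr1 (fun r => dot (param v G xi) (G *m u) * r) centered.
  rewrite mulr0 mulr_sumr => centered'.
  rewrite -[RHS]subr0 -[X in _ - X]centered' -sumrB; apply: eq_bigr => j _.
  by rewrite !mxE dotBl -/(b j); ring.
rewrite covE; under [X in _ = _ * X]eq_bigr do rewrite mulrBr.
rewrite sumrB -[in RHS]mulr_suml.
have -> : param v G xi i 0 = (tilt_mass xi)^-1 * num 0.
  rewrite paramE mxE summxE; congr (_ * _).
  by apply: eq_bigr => j _; rewrite mxE weight0.
have -> : \sum_k0 expR (0 * b k0 + a k0) * b k0 * 1 =
    \sum_j tilt_weight xi j * b j.
  by apply: eq_bigr => j _; rewrite weight0 mulr1.
have -> : \sum_k0 expR (0 * b k0 + a k0) * b k0 * v k0 i 0 =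
    \sum_j tilt_weight xi j * b j * v j i 0.
  by apply: eq_bigr => j _; rewrite weight0.
rewrite den0 -/(num 0) /GRing.scale /=; field.
by rewrite -den0.
Qed.

(** Since p is positive, p^H is the exponential of H^T ln p. *)
Lemma is_derive_param_power d (H : 'M[R]_(m, d)) xi u j :
  (forall xi i, 0 < param v G xi i 0) ->
  is_derive (0 : R) (1 : R) (fun h : R => param_power v G H (h *: u + xi) j 0)
    (param_power v G H xi j 0 *
     \sum_i H i j * ((param v G xi i 0)^-1 * (tilt_cov xi *m (G *m u)) i 0)).
Proof.
move=> p_gt0.
pose lp (h : R) := \sum_i H i j * ln (param v G (h *: u + xi) i 0).
have FE h : param_power v G H (h *: u + xi) j 0 = expR (lp h).
  rewrite mxE expR_sum; apply: eq_bigr => i _.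
  by rewrite /powR gt_eqF// p_gt0.
have -> : (fun h : R => param_power v G H (h *: u + xi) j 0) = expR \o lp.
  by apply/funext => h; rewrite FE.
have -> : param_power v G H xi j 0 = expR (lp 0) by rewrite -FE scale0r add0r.
apply: is_derive1_comp; apply: is_derive_sumr => i.
have dln := is_derive1_ln (p_gt0 (0 *: u + xi) i).
have := @is_derive1_comp R (@ln R) _ 0 _ _ dln (is_derive_param xi u i).
rewrite scale0r add0r => /(is_deriveZ (H i j)).
by [].
Qed.

(** This is J_F = diag(F) H^T diag(1/p) V G, applied to a vector. *)
Lemma jacobian_param_power d (H : 'M[R]_(m, d)) xi u :
  (forall xi i, 0 < param v G xi i 0) ->
  jacobian_mx (param_power v G H) xi *m u =
  hadamard (param_power v G H xi)
    (H^T *m \col_i ((param v G xi i 0)^-1 * (tilt_cov xi *m (G *m u)) i 0)).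
Proof.
move=> p_gt0.
pose M := diag_mx (param_power v G H xi)^T *m H^T *m
  diag_mx (\row_i (param v G xi i 0)^-1) *m tilt_cov xi *m G.
have MuE w : M *m w = hadamard (param_power v G H xi)
    (H^T *m \col_i ((param v G xi i 0)^-1 * (tilt_cov xi *m (G *m w)) i 0)).
  rewrite /M -!mulmxA mul_diag_mx; apply/colP => i; rewrite !mxE.
  congr (_ * _); apply: eq_bigr => a _; congr (_ * _).
  by rewrite mul_diag_mx !mxE.
suff -> : jacobian_mx (param_power v G H) xi = M by [].
apply/matrixP => i j; rewrite [LHS]mxE derive_line.
have [_ ->] := is_derive_param_power H xi (delta_mx j 0) i p_gt0.
transitivity ((col j M) i 0); last by rewrite mxE.
rewrite colE MuE [RHS]mxE; congr (_ * _); rewrite [RHS]mxE.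
by apply: eq_bigr => a _; rewrite !mxE.
Qed.

End param.

(** * The parametrization of the polytope *)

Lemma injective_unitmx (F : fieldType) n (M : 'M[F]_n) :
  (forall c : 'cV[F]_n, M *m c = 0 -> c = 0) -> M \in unitmx.
Proof.
move=> Minj; rewrite -unitmx_tr -row_free_unit -kermx_eq0.
apply/rowV0P => u /sub_kermxP uM.
apply: trmx_inj; rewrite trmx0; apply: Minj.
by rewrite -[M]trmxK -trmx_mul uM trmx0.
Qed.

Section polytope_param.
Variables (R : realType) (l m k N : nat) (A : 'M[R]_(l, m)).
Variables (v : 'I_N -> 'cV[R]_m) (G : 'M[R]_(m, k)).
Let P := coef_polytope A.
Let T := aug_kernel A.
Hypothesis P_neq0 : P !=set0.
Hypothesis G_orthonormal : orthonormal_cols G.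
Hypothesis im_G : mx_image G = T.
Hypothesis v_vertices : range v = vertices (closure P).

Lemma vertex_index z : vertices (closure P) z -> exists i, z = v i.
Proof. by rewrite -v_vertices => -[i _ <-]; exists i. Qed.

Lemma vertex_in_closure i : closure P (v i).
Proof.
have : vertices (closure P) (v i) by rewrite -v_vertices; exists i.
by case.
Qed.

Lemma vertices_gt0 : (0 < N)%N.
Proof.
have [y Py] := P_neq0.
have [z /vertex_index[[i iN] _] _] := coef_polytope_vertex_ge 0 Py.
exact: leq_ltn_trans iN.
Qed.

(** Positivity holds because each coordinate, being positive somewhere on P, is
    positive at some vertex, and all vertices have positive weight. *)
Lemma param_in_polytope xi : P (param v G xi).
Proof.
have Z_gt0 := tilt_mass_gt0 v G vertices_gt0 xi.
have v_cl i := closure_coef_polytope (@vertex_in_closure i).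
have Ap : A *m param v G xi = 0.
  rewrite paramE -scalemxAr mulmx_sumr big1 ?scaler0// => i _.
  by rewrite -scalemxAr (v_cl i).1 scaler0.
have p1 : dot (const_mx 1) (param v G xi) = 1.
  rewrite paramE dotZr dotC dot_suml -[RHS](mulVf (lt0r_neq0 Z_gt0)).
  congr (_ * _); apply: eq_bigr => i _.
  by rewrite dotC (v_cl i).2.2 mulr1.
have p_gt0 i : 0 < param v G xi i 0.
  have [y Py] := P_neq0.
  have [z /vertex_index[j ->]] := coef_polytope_vertex_ge (delta_mx i 0) Py.
  rewrite !dot_delta => /(lt_le_trans (Py.1.2 i)) vj_gt0.
  rewrite paramE mxE mulr_gt0 ?invr_gt0// summxE (bigD1 j)//= ltr_pwDl//.
    by rewrite mxE mulr_gt0 ?expR_gt0.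
  apply: sumr_ge0 => a _; rewrite mxE mulr_ge0 ?expR_ge0//.
  exact: (v_cl a).2.1.
by split; split => // i; exact: ltW.
Qed.

Lemma param_gt0 xi i : 0 < param v G xi i 0.
Proof. by have [[_]] := param_in_polytope xi. Qed.

Lemma polytope_subr_in_T x y : closure P x -> closure P y -> T (x - y).
Proof.
move=> /closure_coef_polytope[Ax [_ x1]] /closure_coef_polytope[Ay [_ y1]].
apply/aug_kernelP; rewrite mulmxBr Ax Ay subrr; split=> //.
by rewrite dotC dotBl ![dot _ (const_mx 1)]dotC x1 y1 subrr.
Qed.

Lemma im_G_in_T u : T (G *m u).
Proof. by rewrite -im_G; exists u. Qed.

(** G has orthonormal columns, so G G^T is the orthogonal projection onto T. *)
Lemma T_coord t : T t -> t = G *m (G^T *m t).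
Proof.
rewrite -im_G => -[u _ <-].
by rewrite (mulmxA G^T) orthonormal_colsP// mul1mx.
Qed.

Lemma dot_isometry u : dot (G *m u) (G *m u) = dot u u.
Proof. by rewrite dot_mulmxr mulmxA orthonormal_colsP// mul1mx. Qed.

Lemma tilt_cov_in_T xi t : T (tilt_cov v G xi *m t).
Proof.
rewrite tilt_cov_mul /T /aug_kernel /mx_kernel /= -scalemxAr mulmx_sumr.
rewrite big1 ?scaler0// => i _; rewrite -scalemxAr.
have pP := subset_closure (param_in_polytope xi).
have := polytope_subr_in_T (@vertex_in_closure i) pP.
rewrite /T /aug_kernel /mx_kernel /= => ->.
exact: scaler0.
Qed.

(** A direction of zero variance is orthogonal to all v_i - p(xi), whereas in
    a nonzero direction of T some vertex lies ahead of p(xi). *)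
Lemma tilt_cov_inj xi t : T t -> tilt_cov v G xi *m t = 0 -> t = 0.
Proof.
move=> Tt /(tilt_cov_eq0 vertices_gt0) vt0.
have [e e_gt0 /(_ t Tt)] := coef_polytope_width (param_in_polytope xi).
move=> [z /vertex_index[i ->]]; rewrite vt0 pmulr_rle0// => t_le0.
apply: dotxx_eq0; apply/eqP; rewrite eq_le dotxx_ge0 andbT.
by rewrite -sqrtr_eq0 eq_le sqrtr_ge0 andbT.
Qed.

(** V maps T injectively into itself, so in the coordinates of the basis G it
    is an invertible square matrix. *)
Lemma tilt_cov_surj xi t : T t -> exists u, t = tilt_cov v G xi *m (G *m u).
Proof.
move=> Tt; pose K := G^T *m (tilt_cov v G xi *m G).
have GK (u : 'cV_k) : G *m (K *m u) = tilt_cov v G xi *m (G *m u).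
  by rewrite /K -!mulmxA -T_coord//; exact: tilt_cov_in_T.
have K_unit : K \in unitmx.
  apply: injective_unitmx => u Ku0.
  have Gu0 : G *m u = 0.
    by apply: (@tilt_cov_inj xi); [exact: im_G_in_T|rewrite -GK Ku0 mulmx0].
  by rewrite -[u]mul1mx -(orthonormal_colsP G_orthonormal) -mulmxA Gu0 mulmx0.
exists (invmx K *m (G^T *m t)).
by rewrite -GK mulKVmx// -T_coord.
Qed.

(** The gradient of sum_i exp ((v_i - y) . G xi) vanishes at some xi; up to a
    positive factor it is G^T (p(xi) - y), and p(xi) - y lies in T. *)
Lemma param_surj y : P y -> exists xi, param v G xi = y.
Proof.
move=> Py; have [e e_gt0 width] := coef_polytope_width Py.
pose c i := G^T *m (v i - y).
have cE i u : dot (c i) u = dot (v i) (G *m u) - dot y (G *m u).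
  by rewrite -dot_mulmxr dotBl.
have [|xi xi0] := @exp_sum_critical_point R N k c e e_gt0.
  move=> u j; have [z /vertex_index[i ->]] := width _ (im_G_in_T u).
  rewrite dot_isometry dotBl -cE => ui; exists i; apply: le_trans ui.
  by rewrite ler_pM2l// -sqrtr_sqr ler_wsqrtr// sqr_coord_le_dotxx.
exists xi.
have {}xi0 : \sum_i tilt_weight v G xi i *: c i = 0.
  transitivity (expR (dot y (G *m xi)) *: \sum_i expR (dot (c i) xi) *: c i).
    rewrite scaler_sumr; apply: eq_bigr => i _.
    by rewrite scalerA -expRD cE addrC subrK.
  by rewrite xi0 scaler0.
have pyT : T (param v G xi - y).
  apply: polytope_subr_in_T; apply: subset_closure => //.
  exact: param_in_polytope.
have Gp : G^T *m (param v G xi - y) = 0.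
  have Z_neq0 := lt0r_neq0 (tilt_mass_gt0 v G vertices_gt0 xi).
  apply: (scalerI Z_neq0); rewrite scaler0 scalemxAr scalerBr paramE.
  rewrite scalerA mulfV// scale1r /tilt_mass scaler_suml -sumrB -[RHS]xi0.
  by rewrite mulmx_sumr; apply: eq_bigr => i _; rewrite -scalerBr scalemxAr.
by apply/eqP; rewrite -subr_eq0 (T_coord pyT) Gp mulmx0.
Qed.

End polytope_param.

Theorem theorem14 (R : realType) (l n m dP d nP : nat)
  (A : 'M[R]_(l, m)) (B : 'M[R]_(n, m))
  (G : 'M[R]_(m, dP)) (H : 'M[R]_(m, d)) (v : 'I_nP -> 'cV[R]_m)
  (C_neq0 : coef_cone A !=set0)
  (dimP : affine_dim (coef_polytope A) dP)
  (G_orthonormal : orthonormal_cols G)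
  (im_G : mx_image G = aug_kernel A)
  (H_basis : basis_mx H (aug_kernel B))
  (dP_eq_d : dP = d)
  (v_inj : injective v)
  (v_vertices : range v = vertices (closure (coef_polytope A))) :
  ~ locally_invertible (param_power v G H)
  <->
  exists y t dbar : 'cV[R]_m,
    [/\ coef_polytope A y, aug_kernel A t /\ t <> 0,
        orth (aug_kernel B) dbar & t = hadamard y dbar].
Proof.
have P_neq0 : coef_polytope A !=set0.
  by have [z [_ [Pz _ _ _]]] := dimP; exists z.
have N_gt0 := vertices_gt0 P_neq0 v_vertices.
have p_gt0 := param_gt0 G P_neq0 v_vertices.
have [_ im_H] := H_basis.
have orthE dbar : orth (aug_kernel B) dbar <-> H^T *m dbar = 0.
  rewrite -im_H; split=> [dB|Hd _ [c _ <-]]; last first.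
    by rewrite dot_mulmxr Hd dotC dot0r.
  apply: dotxx_eq0; rewrite -dot_mulmxr; apply: dB.
  by exists (H^T *m dbar).
have jacE xi u := jacobian_param_power N_gt0 H xi u p_gt0.
split=> [/existsNP[xi]|[y [t [dbar [Py [Tt t_neq0] dB tE]]]] F_inv].
- move=> /existsNP[u1 /existsNP[u2 /not_implyP[Ju12 u12]]].
  pose u := u1 - u2; pose p := param v G xi.
  have Ju : jacobian_mx (param_power v G H) xi *m u = 0.
    by rewrite mulmxBr; apply/eqP; rewrite subr_eq0; apply/eqP.
  pose t := tilt_cov v G xi *m (G *m u).
  exists p, t, (\col_i ((p i 0)^-1 * t i 0)); split.
  + exact: param_in_polytope.
  + split; first exact: tilt_cov_in_T.
    move=> /(tilt_cov_inj P_neq0 v_vertices (im_G_in_T im_G u)) Gu0.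
    apply: u12; apply/eqP; rewrite -subr_eq0 -/u -[u]mul1mx.
    by rewrite -(orthonormal_colsP G_orthonormal) -mulmxA Gu0 mulmx0.
  + apply/orthE; apply/colP => j; move: Ju; rewrite jacE => /matrixP/(_ j 0).
    rewrite !mxE => /eqP; rewrite mulf_eq0 => /orP[|/eqP sum0].
      rewrite gt_eqF// prodr_gt0// => i _; exact: powR_gt0.
    by rewrite -[RHS]sum0; apply: eq_bigr => i _; rewrite !mxE.
  + apply/colP => i; rewrite [RHS]mxE [X in _ = _ * X]mxE mulVKf//.
    by rewrite gt_eqF// p_gt0.
- have [xi xiy] := param_surj P_neq0 G_orthonormal im_G v_vertices Py.
  have [u tu] := tilt_cov_surj P_neq0 G_orthonormal im_G v_vertices xi Tt.
  suff u0 : u = 0 by apply: t_neq0; rewrite tu u0 !mulmx0.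
  apply: (F_inv xi); rewrite mulmx0 jacE -tu xiy.
  have -> : \col_i ((y i 0)^-1 * t i 0) = dbar.
    apply/colP => i; rewrite mxE tE mxE mulKf//.
    by rewrite -xiy gt_eqF// p_gt0.
  have /orthE -> := dB.
  by apply/colP => j; rewrite !mxE mulr0.
Qed.
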